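(* Let $p$ be prime, $a\in\mathbb{Z}_p^\times$, and $k$ an integer with $2\le k\le p-2$ and $\gcd(k,p-1)=1$. Then $D(\eta_{a,k})\le C\,k^{1/4}p^{3/4}\log^2 p$ for an absolute constant $C$ (uniformly in $a$ and $k$).
   Context: $\eta_{a,k}$ is the permutation of $\mathbb{Z}_p$ given by $\eta_{a,k}(s)=as^k$ (a permutation since $\gcd(k,p-1)=1$). An interval of $\mathbb{Z}_n$ is any subset that is the image of an interval of consecutive integers under the projection $\mathbb{Z}\to\mathbb{Z}_n$ (wrap-around allowed). For $S,T\subseteq\mathbb{Z}_n$, $D_T(S)=\bigl|\,|S\cap T|-|S||T|/n\,\bigr|$, and for a permutation $\sigma$ of $\mathbb{Z}_n$, $D(\sigma)=\max_{I,J}D_J(\sigma(I))$ over all intervals $I,J$ of $\mathbb{Z}_n$. *)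

(* Defs.v *)
From Stdlib Require Import Reals.
From mathcomp Require Import all_boot.

Set Implicit Arguments.
Unset Strict Implicit.
Unset Printing Implicit Defensive.

(* Intervals of Z_n (Z_n represented by 'I_n): images of {m, m+1, ..., m+l-1}
   under Z -> Z_n.  Since the image only depends on m mod n, and any l >= n gives
   the whole of Z_n (same as l = n), it suffices to take m < n and l <= n. *)
Definition interval_set (n : nat) (m l : nat) : {set 'I_n} :=
  [set i : 'I_n | [exists j : 'I_l, val i == (m + j) %% n]].

Definition is_interval (n : nat) (S : {set 'I_n}) : bool :=
  [exists m : 'I_n, exists l : 'I_n.+1, S == interval_set n m l].

Definition discT (n : nat) (T S : {set 'I_n}) : R :=
  Rabs (INR #|S :&: T| - INR #|S| * INR #|T| / INR n).

(* D(sigma) = max over intervals I, J of D_J(sigma(I)) (all values are >= 0,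
   so 0 is a neutral element for Rmax here). *)
Definition Dperm (n : nat) (sigma : 'I_n -> 'I_n) : R :=
  \big[Rmax/R0]_(I | @is_interval n I)
    \big[Rmax/R0]_(J | @is_interval n J) discT J (sigma @: I).

(* eta_{a,k}(s) = a s^k in Z_n (the default argument of insubd is never used
   since (a * s^k) %% n < n whenever 'I_n is inhabited). *)
Definition eta (n a k : nat) (s : 'I_n) : 'I_n := insubd s ((a * s ^ k) %% n).
Arguments eta n a k s : clear implicits.

(* Main.v *)
(* Let psi be a nontrivial additive character of F_p and
   S(u, v) = sum_x psi(u x + v x^k).  Substituting x -> t x gives
   S(u, v) = S(u t, v t^k), so for u != 0 the value |S(u, v)|^4 occurs at least
   p - 1 times in the fourth moment of S, which is p^2 times the number of
   solutions of x1 + x2 = x3 + x4, x1^k + x2^k = x3^k + x4^k.  Setting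
   d = x1 - x3 = x4 - x2, a solution with d != 0 has x2 among the roots of a
   nonzero polynomial of degree < k determined by d and x3, so there are at most
   k p^2 solutions and |S(u, v)|^4 <= 2 k p^3.  Since x -> a x^k is a
   permutation, S(u, 0) and S(0, v) vanish for u, v != 0, and Fourier inversion
   bounds the discrepancy by p^-2 max |S| times the product of the L1 norms of
   the Fourier transforms of the two intervals off 0, each O(p log p). *)

Require Import Defs.
From Stdlib Require Import Reals.
From mathcomp Require Import all_boot all_order all_algebra all_fingroup.
From mathcomp Require Import cyclic finfield.
From mathcomp Require Import complex Rstruct zify ring lra.

Set Implicit Arguments.
Unset Strict Implicit.
Unset Printing Implicit Defensive.

Import Order.TTheory GRing.Theory Num.Theory.

Delimit Scope R_scope with coqR.
Local Open Scope ring_scope.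

(** * Power maps on a finite field *)

Section DifferentialUniformity.

Variable F : finFieldType.

Definition graph_quadruples (h : F -> F) : {set (F * F) * (F * F)} :=
  [set t | (t.1.1 + t.1.2 == t.2.1 + t.2.2) &&
           (h t.1.1 + h t.1.2 == h t.2.1 + h t.2.2)].

Definition differentially_uniform (m : nat) (h : F -> F) : Prop :=
  forall d c, d != 0 -> (#|[set x | (h (d + x) - h x == c)%R]| <= m)%N.

Lemma card_graph_quadruples_shift_le h x d :
  (#|[set t in graph_quadruples h | (t.2.1, (t.1.1 - t.2.1)%R) == (x, d)]| <=
   #|[set y | (h (d + y) - h y == h (d + x) - h x)%R]|)%N.
Proof.
rewrite -(@card_in_imset _ _ (fun t => t.1.2)).
  apply/subset_leq_card/subsetP => y /imsetP[[[x1 x2] [x3 x4]]].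
  rewrite !inE /= => /andP[/andP[/eqP sum_x /eqP sum_hx] /eqP[<- <-]] ->.
  have -> : x1 - x3 + x2 = x4 by apply: (addrI x3); rewrite -sum_x; ring.
  by rewrite subrK subr_eq addrAC sum_hx addrAC subrr add0r.
move=> [[x1 x2] [x3 x4]] [[y1 y2] [y3 y4]].
rewrite !inE /= => /andP[/andP[/eqP sum_x _] /eqP[<- <-]].
move=> /andP[/andP[/eqP sum_y _] /eqP[eq_y3 eq_y1]] eq_x2.
move: eq_y1 sum_y; rewrite eq_y3 -eq_x2 => /addIr ->.
by rewrite sum_x => /addrI ->.
Qed.

Lemma card_graph_quadruples_le m h :
  differentially_uniform m h -> (#|graph_quadruples h| <= m.+1 * #|F| ^ 2)%N.
Proof.
move=> unif_h; pose bound (s : F * F) := if s.2 == 0 then #|F| else m.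
pose shift (t : (F * F) * (F * F)) := (t.2.1, t.1.1 - t.2.1).
rewrite -sum1_card (partition_big shift xpredT) //=.
apply: (@leq_trans (\sum_s bound s)).
  apply: leq_sum => -[x d] _; rewrite sum1dep_card.
  apply: leq_trans (card_graph_quadruples_shift_le h x d) _.
  by rewrite /bound /=; case: eqVneq => [_ | /unif_h //]; apply: max_card.
rewrite -(pair_bigA _ (fun x d => bound (x, d))) /bound /=.
rewrite sum_nat_const (bigD1 0) //= eqxx.
under eq_bigr => d nz_d do rewrite (negPf nz_d).
rewrite sum_nat_const (cardC1 (0 : F)) expnS expn1 mulnCA leq_mul2l mulSn.
by rewrite leq_add2l mulnC leq_mul2l leq_pred !orbT.
Qed.

End DifferentialUniformity.

Lemma expr_differentially_uniform (F : finFieldType) k :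
  (1 < k)%N -> k%:R != 0 :> F ->
  differentially_uniform k.-1 (fun x : F => x ^+ k).
Proof.
move=> k_gt1 nz_k d c nz_d; set A := [set y | _].
pose Q := \poly_(i < k) (d ^+ (k - i) *+ 'C(k, i)).
have hornerQ y : Q.[y] = (d + y) ^+ k - y ^+ k.
  rewrite exprDn big_ord_recr /= subnn mul1r binn addrK horner_poly.
  by apply: eq_bigr => i _; rewrite mulrnAl.
have nzP : Q - c%:P != 0.
  apply/eqP => /(congr1 (fun P : {poly F} => P`_k.-1)) /eqP.
  case: k k_gt1 nz_k @Q {A hornerQ} => [|[|k]] //= _ nz_k.
  rewrite coefB coefC coef0 coef_poly ltnSn subr0 subSnn binSn -mulr_natr.
  by rewrite mulf_eq0 (negPf nz_d) (negPf nz_k).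
rewrite cardE -ltnS prednK ?(ltnW k_gt1) //.
have: (size (enum A) < size (Q - c%:P)%R)%N.
  apply: max_poly_roots; rewrite ?enum_uniq //; apply/allP => y.
  by rewrite mem_enum inE rootE hornerD hornerN hornerC hornerQ subr_eq0.
move/leq_trans; apply; rewrite (leq_trans (size_polyD _ _)) // size_polyN.
by rewrite geq_max size_poly (leq_trans (size_polyC_leq1 _)) // ltnW.
Qed.

Lemma expr_inj_coprime (F : finFieldType) k :
  (0 < k)%N -> coprime k #|F|.-1 -> injective (fun x : F => x ^+ k).
Proof.
move=> k_gt0 coprime_k x y /= eq_xy.
have: (x ^+ k == 0) = (y ^+ k == 0) by rewrite eq_xy.
rewrite !expf_eq0 k_gt0 /=; have [-> /esym/eqP -> // | nz_x nz_y] := eqVneq x 0.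
have unit_x : x \is a GRing.unit by rewrite unitfE.
have unit_y : y \is a GRing.unit by rewrite unitfE -nz_y.
pose ux : {unit F} := FinRing.unit F unit_x.
pose uy : {unit F} := FinRing.unit F unit_y.
have /expgK expK : coprime #|[set: {unit F}]| k.
  by rewrite card_finField_unit coprime_sym.
suff /(congr1 val) : ux = uy by [].
apply: (can_in_inj expK); rewrite ?inE //.
by apply: val_inj; rewrite !FinRing.val_unitX.
Qed.

(** * Exponential sums over a finite field *)

Lemma norm_sum_expr_le (C : numFieldType) (z : C) n :
  `|z| = 1 -> z != 1 -> `|\sum_(i < n) z ^+ i| <= 2 / `|z - 1|.
Proof.
move=> z1 z_neq1; rewrite ler_pdivlMr ?normr_gt0 ?subr_eq0 //.
rewrite mulrC -normrM -subrX1 (le_trans (ler_normB _ _)) //.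
by rewrite normrX z1 expr1n normr1 -natr1.
Qed.

Section AdditiveCharacter.

Variables (F : finFieldType) (C : numClosedFieldType).

Record nontrivial_character (psi : F -> C) : Prop := NontrivialCharacter {
  character0 : psi 0 = 1;
  characterD : {morph psi : x y / x + y >-> x * y};
  character_neq1 : exists x, psi x != 1
}.

Variable psi : F -> C.
Hypothesis psiP : nontrivial_character psi.

Lemma characterMn x n : psi (x *+ n) = psi x ^+ n.
Proof.
elim: n => [|n IHn]; first by rewrite mulr0n expr0 (character0 psiP).
by rewrite mulrS exprS (characterD psiP) IHn.
Qed.

Lemma norm_character x : `|psi x| = 1.
Proof.
have psi_card : psi x ^+ #|F| = 1.
  rewrite -characterMn -(character0 psiP); congr psi.
  by have := expg_cardG (in_setT x); rewrite cardsT FinRing.zmodXgE.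
apply/eqP; rewrite -(@pexpr_eq1 _ _ #|F|) ?normr_ge0 //; last first.
  by apply/card_gt0P; exists x.
by rewrite -normrX psi_card normr1.
Qed.

Lemma characterN x : psi (- x) = (psi x)^*.
Proof.
have nz_psi : psi x != 0 by rewrite -normr_eq0 norm_character oner_eq0.
apply: (mulfI nz_psi); rewrite -normCK norm_character expr1n.
by rewrite -(characterD psiP) subrr (character0 psiP).
Qed.

Lemma sum_character a : \sum_x psi (a * x) = #|F|%:R *+ (a == 0).
Proof.
have [-> | nz_a] := eqVneq a 0.
  by under eq_bigr do rewrite mul0r (character0 psiP); rewrite sumr_const.
have [y psi_y] := character_neq1 psiP; rewrite mulr0n.
set S := \sum_x _; have /eqP: S = S * psi y.
  rewrite {1}/S (reindex_inj (addIr (y / a))) mulr_suml /=.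
  apply: eq_bigr => x _.
  by rewrite mulrDr (characterD psiP) mulrCA divff ?mulr1.
rewrite -subr_eq0 -{1}[S]mulr1 -mulrBr mulf_eq0 subr_eq0 [1 == _]eq_sym.
by rewrite (negPf psi_y) orbF => /eqP.
Qed.

Definition dft (g : F -> C) (v : F) : C := \sum_z g z * psi (v * z).

Definition dft_norm1_neq0 (g : F -> C) : C := \sum_(v | v != 0) `|dft g v|.

Definition expsum (h : F -> F) (u v : F) : C := \sum_x psi (u * x + v * h x).

Lemma dft0 g : dft g 0 = \sum_x g x.
Proof. by apply: eq_bigr => x _; rewrite mul0r (character0 psiP) mulr1. Qed.

Lemma dft_inversion g y : \sum_v dft g v * psi (- v * y) = #|F|%:R * g y.
Proof.
under eq_bigr do rewrite mulr_suml; rewrite exchange_big /=.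
transitivity (\sum_z g z * (#|F|%:R *+ (z - y == 0))).
  apply: eq_bigr => z _; rewrite -sum_character mulr_sumr.
  apply: eq_bigr => v _.
  by rewrite -mulrA -(characterD psiP) mulNr -mulrBr [v * _]mulrC.
rewrite (bigD1 y) //= subrr eqxx mulrC big1 ?addr0 // => z z_y.
by rewrite subr_eq0 (negPf z_y) mulr0n mulr0.
Qed.

Lemma dft_correlation f g h :
  #|F|%:R ^+ 2 * \sum_x f x * g (h x) =
  \sum_u \sum_v dft f u * dft g v * expsum h (- u) (- v).
Proof.
transitivity (\sum_x (\sum_u dft f u * psi (- u * x)) *
                     (\sum_v dft g v * psi (- v * h x))).
  rewrite mulr_sumr; apply: eq_bigr => x _.
  by rewrite !dft_inversion expr2 mulrACA.
under eq_bigr do rewrite big_distrlr /=.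
rewrite exchange_big; apply: eq_bigr => u _.
rewrite exchange_big; apply: eq_bigr => v _.
by rewrite mulr_sumr; apply: eq_bigr => x _; rewrite (characterD psiP) mulrACA.
Qed.

Lemma expsum_scale a h u v : expsum (fun x => a * h x) u v = expsum h u (v * a).
Proof. by apply: eq_bigr => x _; rewrite mulrA. Qed.

Lemma expsum00 h : expsum h 0 0 = #|F|%:R.
Proof.
rewrite /expsum; under eq_bigr do rewrite !mul0r addr0 (character0 psiP).
by rewrite sumr_const.
Qed.

Lemma expsum_u0 h u : u != 0 -> expsum h u 0 = 0.
Proof.
move=> nz_u; rewrite /expsum; under eq_bigr do rewrite mul0r addr0.
by rewrite sum_character (negPf nz_u).
Qed.

Lemma expsum_0v h v : injective h -> v != 0 -> expsum h 0 v = 0.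
Proof.
move=> inj_h nz_v; rewrite /expsum; under eq_bigr do rewrite mul0r add0r.
rewrite -(reindex_inj inj_h (P := xpredT) (F := fun x => psi (v * x))).
by rewrite sum_character (negPf nz_v).
Qed.

Lemma dft_correlation_error_le f g h (M : C) :
  injective h -> (forall u v, u != 0 -> `|expsum h u v| <= M) ->
  `|#|F|%:R ^+ 2 * (\sum_x f x * g (h x)) -
    #|F|%:R * ((\sum_x f x) * (\sum_x g x))| <=
  dft_norm1_neq0 f * dft_norm1_neq0 g * M.
Proof.
move=> inj_h leM; rewrite dft_correlation.
rewrite (bigD1 0) //= (bigD1 0) //= big1 ?addr0; last first.
  by move=> v nz_v; rewrite oppr0 expsum_0v ?oppr_eq0 // mulr0.
rewrite oppr0 expsum00 !dft0 [_ * #|F|%:R]mulrC addrAC subrr add0r.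
rewrite /dft_norm1_neq0 big_distrlr mulr_suml.
rewrite (le_trans (ler_norm_sum _ _ _)) //.
apply: ler_sum => u nz_u; rewrite (bigD1 0) //= oppr0 expsum_u0 ?oppr_eq0 //.
rewrite mulr0 add0r mulr_suml (le_trans (ler_norm_sum _ _ _)) //.
apply: ler_sum => v nz_v; rewrite !normrM ler_wpM2l ?mulr_ge0 //.
by rewrite leM ?oppr_eq0.
Qed.

Definition indicator (A : {set F}) (x : F) : C := (x \in A)%:R.

Lemma sum_indicator (A : {set F}) : \sum_x indicator A x = #|A|%:R.
Proof. by rewrite -natr_sum -sum1_card [in RHS]big_mkcond. Qed.

Lemma sum_indicator_inj h (A B : {set F}) : injective h ->
  \sum_x indicator A x * indicator B (h x) = #|h @: A :&: B|%:R.
Proof.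
move=> inj_h; have -> : h @: A :&: B = h @: (A :&: h @^-1: B).
  apply/setP => y; rewrite inE.
  apply/andP/imsetP => [[/imsetP[x Ax ->] Bhx] | [x]].
    by exists x; rewrite // in_setI Ax inE.
  by rewrite in_setI inE => /andP[Ax Bhx] ->; rewrite imset_f.
rewrite card_imset // -sum_indicator; apply: eq_bigr => x _.
by rewrite /indicator in_setI inE -natrM mulnb.
Qed.

Lemma discrepancy_imset_le h (A B : {set F}) (M : C) :
  injective h -> (forall u v, u != 0 -> `|expsum h u v| <= M) ->
  `|#|h @: A :&: B|%:R - #|A|%:R * #|B|%:R / #|F|%:R| <=
  dft_norm1_neq0 (indicator A) * dft_norm1_neq0 (indicator B) * M /
  #|F|%:R ^+ 2.
Proof.
move=> inj_h leM; have q_gt0 : 0 < #|F|%:R :> C.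
  by rewrite ltr0n; apply/card_gt0P; exists 0.
have -> : #|h @: A :&: B|%:R - #|A|%:R * #|B|%:R / #|F|%:R =
    (#|F|%:R ^+ 2 * #|h @: A :&: B|%:R - #|F|%:R * (#|A|%:R * #|B|%:R)) /
    #|F|%:R ^+ 2 :> C.
  by field; rewrite gt_eqF.
rewrite normrM normfV [`|_ ^+ 2|]gtr0_norm ?exprn_gt0 //.
rewrite ler_wpM2r ?invr_ge0 ?exprn_ge0 ?ler0n //.
have := dft_correlation_error_le (indicator A) (indicator B) inj_h leM.
by rewrite sum_indicator_inj // !sum_indicator.
Qed.

Definition natr_interval (m l : nat) : {set F} := [set (m + j)%:R | j : 'I_l].

Lemma norm_dft_natr_interval_le m l u :
  injective (fun j : 'I_l => (m + j)%:R : F) -> psi u != 1 ->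
  `|dft (indicator (natr_interval m l)) u| <= 2 / `|psi u - 1|.
Proof.
move=> inj_natr psi_u.
have -> : dft (indicator (natr_interval m l)) u =
          psi u ^+ m * \sum_(j < l) psi u ^+ j.
  transitivity (\sum_(x in natr_interval m l) psi (u * x)).
    rewrite [RHS]big_mkcond; apply: eq_bigr => x _.
    by rewrite /indicator; case: ifP; rewrite ?mul1r ?mul0r.
  rewrite big_imset /=; last exact: in2W.
  rewrite mulr_sumr; apply: eq_bigr => j _.
  by rewrite mulr_natr characterMn exprD.
rewrite normrM normrX norm_character expr1n mul1r.
by rewrite norm_sum_expr_le ?norm_character.
Qed.

(** * Moments of exponential sums *)

Lemma second_moment (T : finType) (a b : T -> F) :
  \sum_u \sum_v `|\sum_t psi (u * a t + v * b t)| ^+ 2 =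
  #|F|%:R ^+ 2 * #|[set t : T * T | (a t.1 == a t.2) && (b t.1 == b t.2)]|%:R.
Proof.
transitivity (\sum_u \sum_v \sum_t \sum_t'
    psi (u * (a t - a t')) * psi (v * (b t - b t'))).
  apply: eq_bigr => u _; apply: eq_bigr => v _.
  rewrite normCK rmorph_sum big_distrlr /=; apply: eq_bigr => t _.
  apply: eq_bigr => t' _; rewrite -characterN -!(characterD psiP); congr psi.
  by ring.
transitivity (\sum_t \sum_t'
    #|F|%:R ^+ 2 *+ ((a t == a t') && (b t == b t')) : C).
  under eq_bigr do rewrite exchange_big /=.
  rewrite exchange_big /=; apply: eq_bigr => t _.
  under eq_bigr do rewrite exchange_big /=.
  rewrite exchange_big /=; apply: eq_bigr => t' _.
  under eq_bigr do rewrite -mulr_sumr; rewrite -mulr_suml.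
  under eq_bigr do rewrite mulrC; under [X in _ * X]eq_bigr do rewrite mulrC.
  by rewrite !sum_character !subr_eq0 mulrnAl mulrnAr -mulrnA mulnb andbC.
rewrite pair_big /= mulr_natr; move: (_ ^+ 2) => q.
rewrite -sumr_const [in RHS]big_mkcond /=.
by apply: eq_bigr => -[t t'] _; rewrite inE /=; case: ifP.
Qed.

Lemma fourth_moment h :
  \sum_u \sum_v `|expsum h u v| ^+ 4 = #|F|%:R ^+ 2 * #|graph_quadruples h|%:R.
Proof.
rewrite -(second_moment (fun t => t.1 + t.2) (fun t => h t.1 + h t.2)).
apply: eq_bigr => u _; apply: eq_bigr => v _.
rewrite (exprM _ 2 2) -normrX [expsum _ _ _ ^+ 2]expr2 big_distrlr pair_big /=.
congr (`|_| ^+ 2); apply: eq_bigr => t _; rewrite -(characterD psiP); congr psi.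
by ring.
Qed.

Lemma expsum_dilation h t u v : {morph h : x y / x * y} -> t != 0 ->
  expsum h (u * t) (v * h t) = expsum h u v.
Proof.
move=> hM nz_t; rewrite /expsum [RHS](reindex_inj (mulfI nz_t)) /=.
by apply: eq_bigr => x _; rewrite hM !mulrA.
Qed.

Lemma norm_expsum_moment_le h u v n : {morph h : x y / x * y} -> u != 0 ->
  #|F|.-1%:R * `|expsum h u v| ^+ n <= \sum_u' \sum_v' `|expsum h u' v'| ^+ n.
Proof.
move=> hM nz_u.
have norm_ge0 u' v' : 0 <= `|expsum h u' v'| ^+ n by rewrite exprn_ge0.
rewrite (bigD1 0) //= -[leLHS]add0r lerD ?sumr_ge0 //.
rewrite (reindex_inj (mulfI nz_u)) /=.
rewrite (eq_bigl (fun t => t != 0)); last first.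
  by move=> t; rewrite mulf_eq0 negb_or nz_u.
rewrite -(cardC1 (0 : F)) mulr_natl -sumr_const /=.
apply: ler_sum => t nz_t; rewrite (bigD1 (v * h t)) //= expsum_dilation //.
by rewrite lerDl sumr_ge0.
Qed.

Lemma norm_expsum_expr4_le m h u v :
  {morph h : x y / x * y} -> differentially_uniform m h -> u != 0 ->
  `|expsum h u v| ^+ 4 <= 2 * m.+1%:R * #|F|%:R ^+ 3.
Proof.
move=> hM unif_h nz_u; have q_gt1 : (1 < #|F|)%N by apply: finRing_gt1.
have q_pred_gt0 : 0 < #|F|.-1%:R :> C by rewrite ltr0n; lia.
rewrite -(ler_pM2l q_pred_gt0).
rewrite (le_trans (norm_expsum_moment_le v 4 hM nz_u)) //.
rewrite fourth_moment -!natrX -!natrM ler_nat.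
apply: leq_trans (leq_mul (leqnn _) (card_graph_quadruples_le unif_h)) _.
by move: m.+1 => k; nia.
Qed.

End AdditiveCharacter.

(** * Elementary real estimates *)

Lemma ln_sub_ge (x y : R) : 0 < x -> 0 < y -> 1 - x / y <= ln y - ln x.
Proof.
move=> x_gt0 y_gt0; have /RleP := exp_ineq1_le (ln x - ln y).
rewrite -expRD exp_Ropp !exp_ln; [| exact/RltP | exact/RltP].
by rewrite !RealsE; lra.
Qed.

Lemma ln_ge1 (x : R) : 3 <= x -> 1 <= ln x.
Proof.
move=> x_ge3; have /RleP := exp_le_3; rewrite !RealsE /= => e_le3.
have e_gt0 : 0 < exp 1%R by apply/RltP/exp_pos.
have x_gt0 : 0 < x by lra.
have := ln_sub_ge e_gt0 x_gt0; rewrite ln_exp.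
have : exp 1%R / x <= 1 by rewrite ler_pdivrMr // mul1r; lra.
by lra.
Qed.

Lemma sum_inv_le_ln n : (0 < n)%N ->
  \sum_(1 <= i < n.+1) i%:R^-1 <= 1 + ln n%:R.
Proof.
elim: n => // [[|n]] IHn _; first by rewrite big_nat1 invr1 ln_1 addr0.
rewrite big_nat_recr //=.
have := @ln_sub_ge n.+1%:R n.+2%:R; rewrite !ltr0n => /(_ isT isT).
have -> : 1 - n.+1%:R / n.+2%:R = n.+2%:R^-1 :> R.
  rewrite -{1}(@divff _ n.+2%:R) ?pnatr_eq0 // -mulrBl -natrB //.
  by rewrite subSnn mul1r.
move=> le_diff; apply: le_trans (lerD (IHn isT) le_diff) _.
by rewrite -addrA subrKC.
Qed.

Lemma le_sin_PI (x : R) : 0 <= x <= 1 / 2 -> x <= sin (PI * x)%R.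
Proof.
move=> /andP[x_ge0 x_le].
have /RltP := PI2_3_2; have /RleP := PI_4; rewrite !RealsE /= => PI_le4 PI2_gt.
have PI_ge3 : 3 <= PI :> R by lra.
have PIx_ge : 3 * x <= PI * x by nra.
have PIx_le : PI * x <= 2 by nra.
have [||/RleP le_sin _] := sin_bound (PI * x) 0;
  [by apply/RleP; rewrite !RealsE; lra..|].
apply: le_trans le_sin.
have -> : sin_approx (PI * x) ((2 * 0)%coq_nat + 1)%coq_nat =
          PI * x * (1 - (PI * x) ^+ 2 / 6).
  rewrite /sin_approx /sin_term /= -[(-1)%coqR]/(- (1 : R)) !RealsE /=.
  by field.
have PIx2_le : (PI * x) ^+ 2 <= 4 by rewrite expr2; nra.
by move: (PI * x) PIx_ge PIx2_le => y; nra.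
Qed.

Lemma sin_PI_ge (x : R) : 0 <= x <= 1 -> x * (1 - x) <= sin (PI * x)%R.
Proof.
move=> /andP[x_ge0 x_le1].
have [x_le | x_gt] := lerP x (1 / 2).
  have le_sin : x <= sin (PI * x)%R by apply: le_sin_PI; lra.
  by nra.
have -> : PI * x = PI - PI * (1 - x) :> R by ring.
have le_sin : 1 - x <= sin (PI * (1 - x))%R by apply: le_sin_PI; lra.
by rewrite sin_PI_x; nra.
Qed.

(** * Fourier transforms of intervals of a prime field *)

Definition cis (t : R) : R[i] := (cos t +i* sin t)%C.

Lemma cisD s t : cis (s + t) = cis s * cis t.
Proof. by rewrite /cis cosD sinD; simpc; rewrite [sin s * _ + _]addrC. Qed.

Lemma cis0 : cis 0 = 1.
Proof. by rewrite /cis cos_0 sin_0. Qed.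

Lemma cisMn t n : cis (t *+ n) = cis t ^+ n.
Proof.
elim: n => [|n IHn]; first by rewrite mulr0n cis0.
by rewrite mulrS exprS cisD IHn.
Qed.

Lemma cis_PI2 : cis (PI *+ 2) = 1.
Proof. by rewrite mulr2n cisD /cis cos_PI sin_PI; simpc. Qed.

Lemma norm_cis_sub1 t : `|cis (t *+ 2) - 1| = (2 * `|sin t|)%:C%C.
Proof.
have := sin2_cos2 t; rewrite /Rsqr !RealsE => sin2_cos2.
apply/eqP; rewrite -(@eqrXn2 _ 2) ?normr_ge0 ?ler0c ?mulr_ge0 //.
rewrite -add_Re2_Im2 -rmorphXn; apply/eqP; congr (_%:C)%C.
rewrite exprMn real_normK ?num_real // /cis mulr2n cosD sinD /= subr0.
move: (sin t) (cos t) sin2_cos2 => s c s2Dc2.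
have c2 : c * c = 1 - s * s by lra.
transitivity ((c * c - s * s - 1) ^+ 2 + 4 * (s * s) * (c * c)); first by ring.
by rewrite c2; ring.
Qed.

Definition unit_root (p : nat) : R[i] := cis ((PI / p%:R) *+ 2).

Lemma unit_rootX p n : unit_root p ^+ n = cis ((PI * (n%:R / p%:R)) *+ 2).
Proof.
by rewrite -cisMn mulrnAC -[_ / _ *+ n]mulr_natr -mulrA [_^-1 * _]mulrC.
Qed.

Lemma unit_root_expr_p p : (0 < p)%N -> unit_root p ^+ p = 1.
Proof.
by move=> p_gt0; rewrite unit_rootX divff ?mulr1 ?cis_PI2 // pnatr_eq0 -lt0n.
Qed.

Definition chord_lb (p n : nat) : R :=
  (2 * (n%:R / p%:R) * (1 - n%:R / p%:R))%R.

Lemma chord_lb_gt0 p n : (0 < n < p)%N -> 0 < chord_lb p n.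
Proof.
move=> /andP[n_gt0 n_lt_p].
have p_gt0 : 0 < p%:R :> R by rewrite ltr0n (leq_ltn_trans _ n_lt_p).
have x_lt1 : n%:R / p%:R < 1 :> R by rewrite ltr_pdivrMr // mul1r ltr_nat.
by rewrite /chord_lb mulr_gt0 ?subr_gt0 // mulr_gt0 ?divr_gt0 // ltr0n.
Qed.

Lemma norm_unit_rootX_sub1_ge p n : (n < p)%N ->
  (chord_lb p n)%:C%C <= `|unit_root p ^+ n - 1|.
Proof.
move=> n_lt_p; rewrite unit_rootX norm_cis_sub1 lecR /chord_lb -mulrA ler_pM2l //.
apply: le_trans (ler_norm _); apply: sin_PI_ge.
have p_gt0 : 0 < p%:R :> R by rewrite ltr0n (leq_ltn_trans _ n_lt_p).
by rewrite divr_ge0 //= ler_pdivrMr // mul1r ler_nat ltnW.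
Qed.

Lemma unit_rootX_neq1 p n : (0 < n < p)%N -> unit_root p ^+ n != 1.
Proof.
move=> n_bd; rewrite -subr_eq0 -normr_gt0.
apply: lt_le_trans (norm_unit_rootX_sub1_ge (proj2 (andP n_bd))).
by rewrite ltcR chord_lb_gt0.
Qed.

Lemma sum_inv_chord_lb_le p : (2 < p)%N ->
  \sum_(1 <= n < p) 2 / chord_lb p n <= 4 * p%:R * ln p%:R.
Proof.
move=> p_gt2; have p_gt0 : (0 < p)%N by exact: ltnW (ltnW p_gt2).
have -> : \sum_(1 <= n < p) 2 / chord_lb p n =
          \sum_(1 <= n < p) p%:R * (n%:R^-1 + (p - n)%:R^-1).
  apply: eq_big_nat => n /andP[n_gt0 n_lt_p].
  have nz_n : n%:R != 0 :> R by rewrite pnatr_eq0 -lt0n.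
  have nz_p : p%:R != 0 :> R by rewrite pnatr_eq0 -lt0n.
  have nz_pn : p%:R - n%:R != 0 :> R by rewrite subr_eq0 eqr_nat gtn_eqF.
  rewrite /chord_lb natrB ?(ltnW n_lt_p) //; field.
  by rewrite nz_n nz_p nz_pn.
rewrite -mulr_sumr big_split /= [X in _ + X]big_nat_rev /=.
have -> : \sum_(1 <= n < p) (p - (1 + p - n.+1))%:R^-1 =
          \sum_(1 <= n < p) n%:R^-1 :> R.
  by apply: eq_big_nat => n /andP[_ n_lt_p]; rewrite subSS subKn // ltnW.
have sum_le : \sum_(1 <= n < p) n%:R^-1 <= 1 + ln p%:R :> R.
  apply: le_trans (sum_inv_le_ln p_gt0).
  by rewrite big_nat_recr //= lerDl invr_ge0.
have ln_p : 1 <= ln p%:R by apply: ln_ge1; rewrite ler_nat.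
by rewrite -mulrA mulrCA ler_wpM2l //; lra.
Qed.

Lemma Fp_neq0_bounds p (u : 'F_p) : prime p -> u != 0 -> (0 < u < p)%N.
Proof.
by move=> p_pr nz_u; rewrite lt0n -[X in (_ < X)%N](Fp_cast p_pr) ltn_ord andbT.
Qed.

Lemma sum_Fp_neq0 (V : nmodType) p (f : nat -> V) : prime p ->
  \sum_(u : 'F_p | u != 0) f u = \sum_(1 <= n < p) f n.
Proof.
move=> p_pr; rewrite big_add1 big_mkord big_mkcond big_ord_recl /= add0r.
by rewrite -[in RHS](Fp_cast p_pr); apply: eq_bigr.
Qed.

Lemma natr_Fp_inj p m l : prime p -> (l <= p)%N ->
  injective (fun j : 'I_l => (m + j)%:R : 'F_p).
Proof.
move=> p_pr le_lp i j /(congr1 val); rewrite /= !val_Fp_nat // => /eqP.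
rewrite eqn_modDl !modn_small ?(leq_trans (ltn_ord _)) // => /eqP.
exact: val_inj.
Qed.

Section RootCharacter.

Variables (p : nat) (C : numClosedFieldType) (w : C).
Hypotheses (p_pr : prime p) (wp1 : w ^+ p = 1) (w_neq1 : w != 1).

Definition root_character (x : 'F_p) : C := w ^+ x.

Lemma root_character_nat n : root_character n%:R = w ^+ n.
Proof. by rewrite /root_character val_Fp_nat // expr_mod. Qed.

Lemma root_characterP : nontrivial_character root_character.
Proof.
split=> [|x y|]; first by rewrite (root_character_nat 0).
  rewrite -[in LHS](natr_Zp x) -[in LHS](natr_Zp y) -natrD.
  by rewrite root_character_nat exprD.
by exists 1; rewrite (root_character_nat 1).
Qed.

End RootCharacter.

Definition Fp_character (p : nat) : 'F_p -> R[i] :=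
  root_character (unit_root p).
Arguments Fp_character : clear implicits.

Lemma Fp_characterP p : prime p -> nontrivial_character (Fp_character p).
Proof.
move=> p_pr; apply: root_characterP => //.
  exact: unit_root_expr_p (prime_gt0 p_pr).
by rewrite -[unit_root p]expr1 unit_rootX_neq1 ?prime_gt1.
Qed.

Lemma dft_norm1_neq0_natr_interval_le p m l :
  prime p -> (2 < p)%N -> (l <= p)%N ->
  dft_norm1_neq0 (Fp_character p) (indicator _ (natr_interval _ m l)) <=
  (4 * p%:R * ln p%:R)%:C%C.
Proof.
move=> p_pr p_gt2 l_le_p.
apply: (@le_trans _ _ (\sum_(u : 'F_p | u != 0) (2 / chord_lb p u)%:C%C)).
  apply: ler_sum => u nz_u; have u_bd := Fp_neq0_bounds p_pr nz_u.
  have chord_ge := norm_unit_rootX_sub1_ge (proj2 (andP u_bd)).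
  have lb_gt0 : 0 < (chord_lb p u)%:C%C by rewrite ltcR chord_lb_gt0.
  apply: le_trans (norm_dft_natr_interval_le (Fp_characterP p_pr)
    (natr_Fp_inj p_pr l_le_p) (unit_rootX_neq1 u_bd)) _.
  rewrite rmorphM fmorphV rmorph_nat ler_wpM2l // lef_pV2 // posrE //.
  exact: lt_le_trans chord_ge.
rewrite (sum_Fp_neq0 (fun n => (2 / chord_lb p n)%:C%C)) // -rmorph_sum lecR.
exact: sum_inv_chord_lb_le.
Qed.

(** * Discrepancy of the power permutation *)

Lemma Dperm_le n (sigma : 'I_n -> 'I_n) (M : R) : 0 <= M ->
  (forall I J, is_interval I -> is_interval J -> discT J (sigma @: I) <= M) ->
  Dperm sigma <= M.
Proof.
move=> M_ge0 discT_le.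
have RmaxM x y : x <= M -> y <= M -> Rmax x y <= M.
  by rewrite RmaxE ge_max => -> ->.
apply: (big_ind (fun x => x <= M)) => // I int_I.
by apply: (big_ind (fun x => x <= M)) => // J int_J; apply: discT_le.
Qed.

Section PrimeField.

Variables (p : nat) (p_pr : prime p).

Definition Fp_set (T : {set 'I_p}) : {set 'F_p} :=
  cast_ord (Fp_cast p_pr) @^-1: T.

Lemma card_Fp_set T : #|Fp_set T| = #|T|.
Proof.
by apply/on_card_preimset/onW_bij/(Bijective (cast_ordK _))/cast_ordKV.
Qed.

Lemma Fp_set_interval (I : {set 'I_p}) : is_interval I ->
  exists m l, (l <= p)%N /\ Fp_set I = natr_interval _ m l.
Proof.
move=> /existsP[m /existsP[l /eqP ->]]; exists m, l.
split; first by rewrite -ltnS.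
apply/setP => x; rewrite !inE.
apply/existsP/imsetP => [[j /eqP /= xE] | [j _ ->]].
  by exists j => //; apply: val_inj; rewrite [RHS]val_Fp_nat.
by exists j; rewrite [val _]val_Fp_nat.
Qed.

Lemma eta_cast_ord a k (x : 'F_p) :
  eta p a k (cast_ord (Fp_cast p_pr) x) =
  cast_ord (Fp_cast p_pr) (a%:R * x ^+ k).
Proof.
have -> : a%:R * x ^+ k = (a * x ^ k)%:R by rewrite natrM natrX natr_Zp.
apply: val_inj; rewrite /eta val_insubd ltn_pmod ?prime_gt0 //=.
by rewrite val_Fp_nat.
Qed.

Lemma Fp_set_eta a k (I : {set 'I_p}) :
  Fp_set (eta p a k @: I) = (fun x => a%:R * x ^+ k) @: Fp_set I.
Proof.
apply/setP => y; rewrite inE; apply/imsetP/imsetP => [[i Ii eq_y] | [x + ->]].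
  exists (cast_ord (esym (Fp_cast p_pr)) i); first by rewrite inE cast_ordKV.
  apply: (@cast_ord_inj _ _ (Fp_cast p_pr)).
  by rewrite -eta_cast_ord cast_ordKV.
rewrite inE => Ix; exists (cast_ord (Fp_cast p_pr) x) => //.
by rewrite eta_cast_ord.
Qed.

Lemma discT_Fp_set (T S : {set 'I_p}) :
  (discT T S)%:C%C =
  `|#|Fp_set S :&: Fp_set T|%:R - #|Fp_set S|%:R * #|Fp_set T|%:R / #|'F_p|%:R|
  :> R[i].
Proof.
rewrite -preimsetI !card_Fp_set card_Fp // /discT !RealsE.
rewrite -!(rmorph_nat (real_complex R)) -fmorphV -!rmorphM -rmorphB.
by rewrite normc_def /= expr0n addr0 sqrtr_sqr.
Qed.

Section Eta.

Variables (a k : nat).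
Hypotheses (a_p : ~~ (p %| a)%N) (k_bd : (2 <= k <= p - 2)%N).
Hypothesis coprime_k : coprime k (p - 1).

Lemma power_map_inj : injective (fun x : 'F_p => a%:R * x ^+ k).
Proof.
have nz_a : a%:R != 0 :> 'F_p by rewrite -val_eqE /= val_Fp_nat.
move=> x y /(mulfI nz_a); apply: expr_inj_coprime; first by lia.
by rewrite card_Fp // -subn1.
Qed.

Lemma norm_expsum_power_map_le (B : R) (u v : 'F_p) :
  0 <= B -> 2 * k%:R * p%:R ^+ 3 <= B ^+ 4 -> u != 0 ->
  `|expsum (Fp_character p) (fun x => a%:R * x ^+ k) u v| <= B%:C%C.
Proof.
move=> B_ge0 leB nz_u; rewrite -(@ler_pXn2r _ 4%N) ?nnegrE ?normr_ge0 ?ler0c //.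
have [k_gt1 k_lt_p] : (1 < k)%N /\ (0 < k < p)%N by lia.
have nz_k : k%:R != 0 :> 'F_p.
  by rewrite -val_eqE /= val_Fp_nat // modn_small; lia.
rewrite expsum_scale.
have := norm_expsum_expr4_le (Fp_characterP p_pr) (v * a%:R) (@exprMn _ k)
  (expr_differentially_uniform k_gt1 nz_k) nz_u.
rewrite prednK ?(ltnW k_gt1) // card_Fp // => /le_trans; apply.
rewrite -natrX -!natrM -(rmorph_nat (real_complex R)) -rmorphXn lecR.
by rewrite natrM natrX natrM.
Qed.

Lemma discT_eta_le (B : R) (I J : {set 'I_p}) :
  0 <= B -> 2 * k%:R * p%:R ^+ 3 <= B ^+ 4 -> is_interval I -> is_interval J ->
  discT J (eta p a k @: I) <= 16 * ln p%:R ^+ 2 * B.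
Proof.
move=> B_ge0 leB /Fp_set_interval[m [l [l_le_p FpI]]].
move=> /Fp_set_interval[m' [l' [l'_le_p FpJ]]].
have p_gt2 : (2 < p)%N by lia.
have nz_p : p%:R != 0 :> R by rewrite pnatr_eq0 -lt0n prime_gt0.
rewrite -lecR discT_Fp_set Fp_set_eta FpI FpJ.
rewrite card_imset; last exact: power_map_inj.
have leS u v := @norm_expsum_power_map_le B u v B_ge0 leB.
have := discrepancy_imset_le (Fp_characterP p_pr)
  (natr_interval _ m l) (natr_interval _ m' l') power_map_inj leS.
move=> /le_trans; apply; rewrite card_Fp //.
have dft_ge0 f : 0 <= dft_norm1_neq0 (Fp_character p) f by apply: sumr_ge0.
have le_dft := ler_pM (dft_ge0 _) (dft_ge0 _)
  (dft_norm1_neq0_natr_interval_le m p_pr p_gt2 l_le_p)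
  (dft_norm1_neq0_natr_interval_le m' p_pr p_gt2 l'_le_p).
have -> : 16 * ln p%:R ^+ 2 * B =
          (4 * p%:R * ln p%:R) * (4 * p%:R * ln p%:R) * B / p%:R ^+ 2 by field.
rewrite [in leRHS]rmorphM fmorphV rmorphXn rmorph_nat.
rewrite ler_wpM2r ?invr_ge0 ?exprn_ge0 //.
by rewrite 2!rmorphM ler_wpM2r ?ler0c.
Qed.

End Eta.

End PrimeField.

Lemma Rpower_exprn (x y : R) n : Rpower x y ^+ n = Rpower x (y * n%:R)%R.
Proof. by rewrite -RpowE -Rpower_pow ?Rpower_mult ?INRE //; apply: exp_pos. Qed.

Lemma Rpower_quarters_expr4 (x y : R) : 0 < x -> 0 < y ->
  (2 * Rpower x (1 / 4) * Rpower y (3 / 4)) ^+ 4 = 16 * x * y ^+ 3.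
Proof.
move=> /RltP x_gt0 /RltP y_gt0; rewrite !exprMn !Rpower_exprn !RealsE /=.
have -> : 1 / 4 * 4 = 1 :> R by field.
have -> : 3 / 4 * 4 = 3%:R :> R by field.
by rewrite Rpower_1 // -[3%:R]INRE Rpower_pow // RpowE; ring.
Qed.

Local Close Scope ring_scope.
Local Open Scope R_scope.

Theorem mainTheorem8 :
  exists C : R, 0 < C /\
    forall p a k : nat,
      prime p -> ~~ (p %| a)%N -> (2 <= k <= p - 2)%N -> coprime k (p - 1)%N ->
      Dperm (eta p a k) <=
        C * Rpower (INR k) (1 / 4) * Rpower (INR p) (3 / 4) * (ln (INR p)) ^ 2.
Proof.
exists 32; split; first by apply/RltP; rewrite !RealsE ltr0n.
move=> p a k p_pr a_p k_bd coprime_k.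
have [k_gt0 p_gt0] : (0 < k%:R :> R)%R /\ (0 < p%:R :> R)%R.
  by rewrite !ltr0n; lia.
pose B := (2 * Rpower k%:R (1 / 4) * Rpower p%:R (3 / 4))%R.
have B_ge0 : (0 <= B)%R.
  by rewrite !mulr_ge0 ?ler0n //; apply/RleP/Rlt_le; apply: exp_pos.
have B4 : (2 * k%:R * p%:R ^+ 3 <= B ^+ 4)%R.
  rewrite Rpower_quarters_expr4 //.
  by rewrite ler_wpM2r ?exprn_ge0 // ler_wpM2r // ler_nat.
have -> : 32 * Rpower (INR k) (1 / 4) * Rpower (INR p) (3 / 4) *
          ln (INR p) ^ 2 = (16 * ln p%:R ^+ 2 * B)%R.
  by rewrite /B !RealsE /=; ring.
apply/RleP/Dperm_le => [|I J int_I int_J].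
  exact: mulr_ge0 (mulr_ge0 (ler0n _ 16) (sqr_ge0 _)) B_ge0.
exact: discT_eta_le.
Qed.
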